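(* Let $(V,Y,\mathbf 1,\omega)$ be a vertex operator algebra and let $W$ be a vector space (not assumed graded) equipped with a linear map $Y_W(\cdot,x):V\to(\mathrm{End}\,W)[[x,x^{-1}]]$ satisfying the truncation condition and the Jacobi identity for modules. Then for all $u,v\in V$, $$\lim_{x_1\to x_2+x_0}\Big((x_1-x_2)^{k(u,v)}\,Y_W(u,x_1)\,Y_W(v,x_2)\Big)=x_0^{k(u,v)}\,Y_W(Y(u,x_0)v,x_2).$$
   Context: Vector spaces are over $\mathbb C$; $x,x_0,x_1,x_2$ are commuting formal variables; $\delta(x)=\sum_{n\in\mathbb Z}x^n$. Binomial expansion convention: a power of a binomial such as $(x_1-x_2)^n$ is expanded in nonnegative integral powers of the second variable. A vertex operator algebra $(V,Y,\mathbf 1,\omega)$ is a $\mathbb Z$-graded space $V=\coprod_n V_{(n)}$ with $V_{(n)}=0$ for $n$ sufficiently negative and $\dim V_{(n)}<\infty$, with a linear map $v\mapsto Y(v,x)=\sum_{n\in\mathbb Z}v_nx^{-n-1}\in(\mathrm{End}\,V)[[x,x^{-1}]]$ and vectors $\mathbf 1,\omega\in V$ such that: for $v,w\in V$, $v_nw=0$ for $n$ large; $Y(\mathbf 1,x)=1_V$; $Y(v,x)\mathbf 1\in V[[x]]$ with constant term $v$; writing $Y(\omega,x)=\sum_n L(n)x^{-n-2}$, $[L(m),L(n)]=(m-n)L(m+n)+c_V\frac{m^3-m}{12}\delta_{m+n,0}1_V$ for some $c_V\in\mathbb C$, $L(0)v=nv$ for $v\in V_{(n)}$, $Y(L(-1)u,x)=\frac{d}{dx}Y(u,x)$;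 and the Jacobi identity $x_0^{-1}\delta\big(\frac{x_1-x_2}{x_0}\big)Y(u,x_1)Y(v,x_2)-x_0^{-1}\delta\big(\frac{x_2-x_1}{-x_0}\big)Y(v,x_2)Y(u,x_1)=x_2^{-1}\delta\big(\frac{x_1-x_0}{x_2}\big)Y(Y(u,x_0)v,x_2)$. Write $Y_W(v,x)=\sum_{n\in\mathbb Z}v_n^Wx^{-n-1}$. Truncation condition: for $v\in V$, $w\in W$, $v_n^Ww=0$ for $n$ sufficiently large. Jacobi identity for modules: $x_0^{-1}\delta\big(\frac{x_1-x_2}{x_0}\big)Y_W(u,x_1)Y_W(v,x_2)-x_0^{-1}\delta\big(\frac{x_2-x_1}{-x_0}\big)Y_W(v,x_2)Y_W(u,x_1)=x_2^{-1}\delta\big(\frac{x_1-x_0}{x_2}\big)Y_W(Y(u,x_0)v,x_2)$ for $u,v\in V$. For $u,v\in V$, $k(u,v)$ is the smallest nonnegative integer $k$ such that weak commutativity $(x_1-x_2)^kY_W(u,x_1)Y_W(v,x_2)=(x_1-x_2)^kY_W(v,x_2)Y_W(u,x_1)$ holds. The formal limit $\lim_{x_1\to x_2+x_0}f(x_1,x_2)$ means: replace each power $x_1^n$ in the (fully multiplied out) formal series $f$ by $(x_2+x_0)^n$, expanded in nonnegative powers of $x_0$ (operators being applied to an arbitrary fixed vector $w\in W$); that this is well defined is part of the assertion. *)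

(* Defs.v *)
From HB Require Import structures.
From mathcomp Require Import all_boot all_order all_algebra.
From mathcomp Require Import all_classical all_reals.
From mathcomp Require Export complex.

Set Implicit Arguments.
Unset Strict Implicit.
Unset Printing Implicit Defensive.

Import Order.TTheory GRing.Theory Num.Theory.
Local Open Scope classical_set_scope.
Local Open Scope ring_scope.

(* A formal series in x0, x1, x2 (integer exponents, no support condition) with
   coefficients in U is its coefficient function: f (a0, a1, a2) is the
   coefficient of x0^a0 x1^a1 x2^a2.  A series in fewer of the variables has
   coefficient 0 wherever an absent variable has a nonzero exponent. *)
Definition expo : Type := (int * int * int)%type.

Definition fseries1 (U : Type) := int -> U.
Definition fseries3 (U : Type) := expo -> U.

Section FormalCalculus.
Variable K : numFieldType.

Definition gbinom (n : int) (i : nat) : K :=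
  (\prod_(j < i) (n%:~R - j%:R)) / (i`!)%:R.

(* Coefficient of y^i z^j in (y + s z)^n, expanded in nonnegative powers of
   the second variable z. *)
Definition binom_pow (s : K) (n i j : int) : K :=
  if (0 <= j) && (i + j == n) then s ^+ `|j|%N * gbinom n `|j|%N else 0.

(* x0^-1 delta((x1 - x2)/x0) = \sum_n x0^(-n-1) (x1 - x2)^n *)
Definition delta_12_0 : fseries3 K := fun '(a0, a1, a2) =>
  binom_pow (-1) (- a0 - 1) a1 a2.

(* x0^-1 delta((x2 - x1)/(-x0)) = \sum_n (-1)^n x0^(-n-1) (x2 - x1)^n *)
Definition delta_21_N0 : fseries3 K := fun '(a0, a1, a2) =>
  (-1) ^ (- a0 - 1) * binom_pow (-1) (- a0 - 1) a2 a1.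

(* x2^-1 delta((x1 - x0)/x2) = \sum_n x2^(-n-1) (x1 - x0)^n *)
Definition delta_10_2 : fseries3 K := fun '(a0, a1, a2) =>
  binom_pow (-1) (- a2 - 1) a1 a0.

Definition pow_x1Bx2 (k : nat) : fseries3 K := fun '(a0, a1, a2) =>
  if a0 == 0 then binom_pow (-1) k%:Z a1 a2 else 0.

Definition pow_x0 (k : nat) : fseries3 K := fun a =>
  if a == (k%:Z, 0, 0) then 1 else 0.

Variable W : lmodType K.

(* Cauchy product.  The \sum over setT is the sum over the finite support; it
   would be 0 if the support were infinite, which never happens below: one
   factor is a polynomial, or one is a delta series and the truncation
   conditions make every coefficient a finite sum. *)
Definition fmul (f : fseries3 K) (g : fseries3 W) : fseries3 W := fun p =>
  \sum_(q \in [set: expo]) (f q *: g (p - q)).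

(* Coefficient at x0^p0 x1^p1 x2^p2 of the term f_q x0^q0 (x2 + x0)^q1 x2^q2
   which replaces f_q x0^q0 x1^q1 x2^q2 in the substitution x1 = x2 + x0. *)
Definition subst_term (f : fseries3 W) (p q : expo) : W :=
  let: (p0, p1, p2) := p in
  let: (q0, q1, q2) := q in
  (if p1 == 0 then binom_pow 1 q1 (p2 - q2) (p0 - q0) else 0) *: f q.

Definition formal_lim_exists (f : fseries3 W) : Prop :=
  forall p, finite_set [set q | subst_term f p q != 0].

Definition formal_lim (f : fseries3 W) : fseries3 W := fun p =>
  \sum_(q \in [set: expo]) subst_term f p q.

Definition fderiv (f : fseries1 W) : fseries1 W := fun e =>
  (e + 1)%:~R *: f (e + 1).

End FormalCalculus.

Section VertexOperators.
Variables (K : numFieldType) (V W : lmodType K).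

(* Y v n is the mode v_n, i.e. Y(v,x) = \sum_n (Y v n) x^(-n-1). *)
Definition modes := V -> int -> {linear W -> W}.

Definition linear_modes (Y : modes) : Prop :=
  forall n w, linear (fun v => Y v n w).

Definition truncation (Y : modes) : Prop :=
  forall v w, exists N : int, forall n, N <= n -> Y v n w = 0.

(* Y(v,x)w *)
Definition vop (Y : modes) (v : V) (w : W) : fseries1 W := fun e =>
  Y v (- e - 1) w.

(* Y(u,x1) Y(v,x2) w *)
Definition prod_12 (Y : modes) (u v : V) (w : W) : fseries3 W :=
  fun '(a0, a1, a2) =>
    if a0 == 0 then Y u (- a1 - 1) (Y v (- a2 - 1) w) else 0.

(* Y(v,x2) Y(u,x1) w *)
Definition prod_21 (Y : modes) (u v : V) (w : W) : fseries3 W :=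
  fun '(a0, a1, a2) =>
    if a0 == 0 then Y v (- a2 - 1) (Y u (- a1 - 1) w) else 0.

Definition weak_commutativity (Y : modes) (u v : V) (k : nat) : Prop :=
  forall w, fmul (pow_x1Bx2 K k) (prod_12 Y u v w) =1
            fmul (pow_x1Bx2 K k) (prod_21 Y u v w).

(* k is k(u,v); this determines k but does not build in its existence. *)
Definition is_comm_order (Y : modes) (u v : V) (k : nat) : Prop :=
  weak_commutativity Y u v k /\
  forall j, weak_commutativity Y u v j -> (k <= j)%N.

End VertexOperators.

Section Jacobi.
Variables (K : numFieldType) (V W : lmodType K).

(* YW(Y(u,x0)v, x2) w *)
Definition iterate_02 (Y : modes V V) (YW : modes V W) (u v : V) (w : W) :
    fseries3 W :=
  fun '(a0, a1, a2) =>
    if a1 == 0 then YW (Y u (- a0 - 1) v) (- a2 - 1) w else 0.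

Definition jacobi (Y : modes V V) (YW : modes V W) : Prop :=
  forall u v w p,
    fmul (delta_12_0 K) (prod_12 YW u v w) p
      - fmul (delta_21_N0 K) (prod_21 YW u v w) p
    = fmul (delta_10_2 K) (iterate_02 Y YW u v w) p.

End Jacobi.

Section VOA.
Variables (K : numFieldType) (V : lmodType K).

Definition subspace (A : set V) : Prop :=
  A 0 /\ forall (a : K) u v, A u -> A v -> A (a *: u + v).

Definition finite_dim (A : set V) : Prop :=
  exists (d : nat) (b : 'I_d -> V), (forall i, A (b i)) /\
    forall v, A v -> exists c : 'I_d -> K, v = \sum_(i < d) c i *: b i.

Definition direct_sum_decomposition (G : int -> set V) : Prop :=
  [/\ forall n, subspace (G n),
      forall v, exists (s : seq int) (c : int -> V),
        (forall n, G n (c n)) /\ v = \sum_(n <- s) c n &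
      forall (s : seq int) (c : int -> V), uniq s -> (forall n, G n (c n)) ->
        \sum_(n <- s) c n = 0 -> forall n, n \in s -> c n = 0].

Record voa := Voa {
  voa_grade : int -> set V;
  voa_Y : modes V V;
  voa_vac : V;
  voa_omega : V;
  voa_rank : K;
  voa_graded : direct_sum_decomposition voa_grade;
  voa_grade_bounded_below :
    exists N : int, forall n, n < N -> voa_grade n = [set 0];
  voa_grade_finite_dim : forall n, finite_dim (voa_grade n);
  voa_linear : linear_modes voa_Y;
  voa_truncation : truncation voa_Y;
  voa_vacuum : forall w e,
    vop voa_Y voa_vac w e = if e == 0 then w else 0;
  voa_creation : forall v,
    (forall e, e < 0 -> vop voa_Y v voa_vac e = 0) /\
    vop voa_Y v voa_vac 0 = v;
  (* L(n) is the mode of omega of index n + 1. *)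
  voa_L := fun n : int => voa_Y voa_omega (n + 1);
  voa_virasoro : forall (m n : int) w,
    voa_L m (voa_L n w) - voa_L n (voa_L m w)
    = (m - n)%:~R *: voa_L (m + n) w
      + (if m + n == 0 then (voa_rank * (m ^+ 3 - m)%:~R / 12%:R) *: w else 0);
  voa_L0 : forall (n : int) v, voa_grade n v -> voa_L 0 v = n%:~R *: v;
  voa_Lm1 : forall u w,
    vop voa_Y (voa_L (-1) u) w =1 fderiv (vop voa_Y u w);
  voa_jacobi : jacobi voa_Y voa_Y
}.

End VOA.

(* Main.v *)
Require Import Defs.
From mathcomp Require Import all_boot all_order all_algebra.
From mathcomp Require Import all_classical all_reals.
From mathcomp Require Import zify ring.

(** The limit formula is the [Res_{x1}] of the Jacobi identity, multiplied by
    [x0^k].  Write [n = k - m - 1].  Comparing coefficients of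
    [x0^(m-k) x1^(-1)] in the Jacobi identity expresses every coefficient of
    [Y_W(Y(u,x0)v,x2)w] as
    [Res_{x1} (x1-x2)^n Y_W(u,x1)Y_W(v,x2)w - Res_{x1} (x1-x2)^n
    Y_W(v,x2)Y_W(u,x1)w], the first power of [x1-x2] being expanded at
    [x1 = oo] and the second one at [x1 = 0] ([iterate_residue]).

    Weak commutativity of order [k] says that [F = (x1-x2)^k
    Y_W(u,x1)Y_W(v,x2)w] is also [(x1-x2)^k Y_W(v,x2)Y_W(u,x1)w].  The
    truncation condition bounds the powers of [x2] below in the first
    expression and those of [x1] below in the second, so that in each total
    degree [F] is a Laurent polynomial ([finite_slice]): this is why the
    substitution [x1 = x2 + x0] is well defined.  In the difference of residues
    [(x1-x2)^n] may be split as [(x1-x2)^(-m-1) (x1-x2)^k], and the factor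
    [(x1-x2)^k] moved onto the series ([summation_by_parts]); there remains the
    pairing of [F] with the difference of the two expansions of
    [(x1-x2)^(-m-1)].  The latter is the generating series of the binomial
    coefficients [binom(a,m)] ([res_inf_sub_zero]), that is, it extracts the
    coefficient of [x0^m] in [(x2+x0)^a] ([residue_sum]).

    Existence of some [k] with weak commutativity comes from the coefficients of
    [x0^(-k-1)] in the Jacobi identity: for [k] large the right-hand side
    vanishes by truncation of [Y(u,x0)v], and the two expansions of [(x1-x2)^k]
    coincide ([weak_commutativity_exists]).

    Since everything is homogeneous, [x2] is set to [1] in each fixed total
    degree, and only series in one variable [x = x1] are manipulated.  All the
    facts needed on expansions of [(x-1)^n] follow from the relation
    [c (n+1) a = c n (a+1) - c n a] satisfied by the residues [c n a] of
    [x^a (x-1)^n], that is, from Pascal's rule. *)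

Set Implicit Arguments.
Unset Strict Implicit.
Unset Printing Implicit Defensive.
Import Order.TTheory GRing.Theory Num.Theory.
Local Open Scope classical_set_scope.
Local Open Scope ring_scope.

(** * Sums over finite supports *)

Section FiniteSums.
Variable U : zmodType.
Implicit Types (f g : int -> U).

(** A function with finitely many nonzero values, so that its sum over [setT] is
    the genuine one and not the default value [0]. *)
Definition finsupp (T : Type) (f : T -> U) := finite_set [set a | f a != 0].

Lemma finite_int_interval (lo hi : int) : finite_set [set a : int | lo <= a <= hi].
Proof.
apply: (@sub_finite_set _ _ ((fun i : nat => lo + i%:Z) @` `I_(`|hi - lo|.+1))).
  move=> a /= /andP[h1 h2]; exists `|a - lo|%N; lia.
exact: finite_image.
Qed.

Lemma finsupp_bounded f (lo hi : int) :
  (forall a, a < lo -> f a = 0) -> (forall a, hi < a -> f a = 0) -> finsupp f.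
Proof.
move=> h1 h2; apply: sub_finite_set (finite_int_interval lo hi) => a /= fa.
apply/andP; split; rewrite leNgt; apply/negP => h; move/eqP: fa; apply.
- exact: h1.
- exact: h2.
Qed.

Lemma fsum_subr f g : finsupp f -> finsupp g ->
  \sum_(a \in setT) (f a - g a) = \sum_(a \in setT) f a - \sum_(a \in setT) g a.
Proof.
move=> ff fg; set D := [set a | f a != 0] `|` [set a | g a != 0].
have finD : finite_set D by rewrite finite_setU.
have widen (h : int -> U) : (forall a, h a != 0 -> D a) ->
    \sum_(a \in setT) h a = \sum_(a \in D) h a.
  move=> hD; apply/esym/fsbig_widen => // a [_ /= nDa].
  by apply/eqP/negPn/negP => /hD.
rewrite (widen f) ?(widen g) ?(widen (fun a => f a - g a)); first last.
- by move=> a fa; left.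
- by move=> a ga; right.
- move=> a; case: (eqVneq (f a) 0) => [fa0|]; last by left.
  by rewrite fa0 sub0r oppr_eq0 => ga; right.
by rewrite !fsbig_finite// sumrB.
Qed.

Lemma fsum_shift f (d : int) :
  \sum_(a \in setT) f (a + d) = \sum_(a \in setT) f a.
Proof.
apply/esym/(@reindex_fsbigT _ _ _ _ _ (fun a => a + d)).
by exists (fun a => a - d) => a; rewrite ?addrK ?subrK.
Qed.

(** No finiteness is needed: the supports of [f] and of [f \o h] are equipotent,
    so both sums take the default value [0] at the same time. *)
Lemma fsum_injective (S T : choiceType) (h : S -> T) (f : T -> U) :
  injective h -> (forall q, f q != 0 -> exists a, h a = q) ->
  \sum_(q \in setT) f q = \sum_(a \in setT) f (h a).
Proof.
move=> hinj hsupp; rewrite -(@fsbig_image _ _ +%R _ _ setT h f).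
  apply/esym/fsbig_widen => // q [_ /= nq].
  apply/eqP/negPn/negP => /hsupp[a ha]; apply: nq; by exists a.
by move=> a b _ _ /hinj.
Qed.

Lemma fsum_single (T : choiceType) (f : T -> U) (t : T) :
  (forall q, q != t -> f q = 0) -> \sum_(q \in setT) f q = f t.
Proof.
move=> h; rewrite -(@fsbig_set1 _ _ +%R _ t f); apply/esym/fsbig_widen => // q [_ /=].
by move/eqP/h.
Qed.

End FiniteSums.

(** * Residues of the two expansions of x^a (x - 1)^n *)

Section Residues.
Variable K : numFieldType.

Lemma gbinom0 (n : int) : gbinom K n 0 = 1.
Proof. by rewrite /gbinom big_ord0 divr1. Qed.

Lemma gbinom0S (i : nat) : gbinom K 0 i.+1 = 0.
Proof. by rewrite /gbinom big_ord_recl subrr !mul0r. Qed.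

Lemma gbinom_pascal (n : int) (i : nat) :
  gbinom K (n + 1) i.+1 = gbinom K n i.+1 + gbinom K n i.
Proof.
rewrite /gbinom big_ord_recl [in X in _ = X + _]big_ord_recr /=.
under eq_bigr => j _ do rewrite /bump /= add1n.
have -> : \prod_(j < i) ((n + 1)%:~R - j.+1%:R) = \prod_(j < i) (n%:~R - j%:R) :> K.
  by apply: eq_bigr => j _; rewrite -[j.+1%:R]natr1 intrD; ring.
rewrite factS natrM invfM -[i.+1%:R]natr1 intrD.
have h1 : (i`!)%:R != 0 :> K by rewrite pnatr_eq0 -lt0n fact_gt0.
have h2 : i%:R + 1 != 0 :> K by rewrite natr1 pnatr_eq0.
by field; rewrite h1 h2.
Qed.

(** Coefficient of [z^j] in [(1 - z)^n], expanded in nonnegative powers of [z]. *)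
Definition sbinom (n j : int) : K :=
  if 0 <= j then (-1) ^+ `|j|%N * gbinom K n `|j|%N else 0.

Lemma sbinom_pascal (n j : int) :
  sbinom (n + 1) j = sbinom n j - sbinom n (j - 1).
Proof.
case: j => [[|j]|j].
- by rewrite /sbinom /= !gbinom0 subr0.
- have -> : j.+1%:Z - 1 = j by lia.
  by rewrite /sbinom /= gbinom_pascal exprS; ring.
- have -> : Negz j - 1 = Negz j.+1 by lia.
  by rewrite /sbinom /= subr0.
Qed.

Lemma sbinom_lt0 (n j : int) : j < 0 -> sbinom n j = 0.
Proof. by rewrite /sbinom leNgt => ->. Qed.

Lemma binom_pow_sbinom (n i j : int) :
  binom_pow (-1 : K) n i j = if i + j == n then sbinom n j else 0.
Proof. by rewrite /binom_pow /sbinom; case: (0 <= j); case: (i + j == n). Qed.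

(** Coefficient of [x^(-1)] in [x^a (x - 1)^n], with [(x - 1)^n] expanded in
    nonnegative powers of [x^(-1)]. *)
Definition res_inf (n a : int) : K := sbinom n (n + a + 1).

(** Coefficient of [x^(-1)] in [x^a (x - 1)^n], with
    [(x - 1)^n = (-1)^n (1 - x)^n] expanded in nonnegative powers of [x]. *)
Definition res_zero (n a : int) : K := (-1) ^ n * sbinom n (- a - 1).

(** [x^a (x - 1)^(n+1) = x^(a+1) (x - 1)^n - x^a (x - 1)^n]. *)
Lemma res_inf_rec n a : res_inf (n + 1) a = res_inf n (a + 1) - res_inf n a.
Proof. by rewrite /res_inf sbinom_pascal; congr (sbinom _ _ - sbinom _ _); lia. Qed.

Lemma res_zero_rec n a : res_zero (n + 1) a = res_zero n (a + 1) - res_zero n a.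
Proof.
rewrite /res_zero sbinom_pascal expfzDr ?oppr_eq0 ?oner_eq0// expr1z.
have -> : - (a + 1) - 1 = - a - 1 - 1 by lia.
by ring.
Qed.

Lemma sbinom0 j : sbinom 0 j = (j == 0)%:R.
Proof.
rewrite /sbinom; case: j => [[|j]|j] //=; first by rewrite gbinom0 mulr1.
by rewrite gbinom0S mulr0.
Qed.

(** For [n >= 0], [(x - 1)^n] is a polynomial, and has only one expansion. *)
Lemma res_inf_zeroE (n : nat) a : res_inf n a = res_zero n a.
Proof.
elim: n a => [|n IH] a.
  rewrite /res_inf /res_zero expr0z mul1r !sbinom0; congr (_%:R); lia.
by rewrite -addn1 PoszD res_inf_rec res_zero_rec !IH.
Qed.

Lemma sbinomN1 j : sbinom (-1) j = (0 <= j)%R%:R.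
Proof.
have h : forall j, sbinom (-1) j - sbinom (-1) (j - 1) = (j == 0)%:R.
  by move=> i; rewrite -sbinom_pascal sbinom0.
case: j => [j|j]; last by rewrite sbinom_lt0.
elim: j => [|j IH].
  by rewrite -[LHS]subr0 -[X in _ - X](@sbinom_lt0 (-1) (0 - 1)) // h.
have := h j.+1%:Z; have -> : j.+1%:Z - 1 = j by lia.
by rewrite IH => /eqP; rewrite subr_eq add0r => /eqP ->.
Qed.

Lemma eq_by_difference (U : zmodType) (f g : int -> U) :
  f 0 = g 0 -> (forall a, f (a + 1) - f a = g (a + 1) - g a) -> f =1 g.
Proof.
move=> h0 hS; case=> n.
  elim: n => [//|n IH]; have := hS n%:Z.
  have -> : n%:Z + 1 = n.+1 by lia.
  by rewrite IH => /addIr.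
have -> : Negz n = - (n.+1)%:Z by lia.
elim: n.+1 => [|m IH]; first by rewrite oppr0.
have := hS (- m.+1%:Z).
have -> : - m.+1%:Z + 1 = - m%:Z by lia.
by rewrite IH => /addrI /oppr_inj.
Qed.

(** The difference of the two expansions of [(x - 1)^(-m-1)] is the [m]-th
    derivative of the delta series divided by [m!], up to sign: its pairing with
    [x^a] is [binom(a,m)]. *)
Lemma res_inf_sub_zero (m : nat) a :
  res_inf (- m%:Z - 1) a - res_zero (- m%:Z - 1) a = gbinom K a m.
Proof.
elim: m a => [|m IH] a.
  (* Both terms are geometric series: 1 comes from the first one if a >= 0,
     and from the second one if a < 0. *)
  rewrite gbinom0 oppr0 sub0r /res_inf /res_zero !sbinomN1.
  have -> : (-1 : K) ^ (-1) = -1 by rewrite exprN1 invrN1.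
  have -> : (0 <= -1 + a + 1) = (0 <= a) by lia.
  have -> : (0 <= - a - 1) = (a < 0) by lia.
  by case: ltP => _ /=; rewrite ?mulr0 ?mulr1 ?subr0 ?sub0r ?opprK.
move: a; apply: (eq_by_difference (f := fun a =>
  res_inf (- m.+1%:Z - 1) a - res_zero (- m.+1%:Z - 1) a)) => [|a].
  rewrite gbinom0S /res_inf /res_zero.
  by rewrite !sbinom_lt0 ?mulr0 ?subr0//; lia.
have e : - m%:Z - 1 = (- m.+1%:Z - 1) + 1 by lia.
have := IH a; rewrite {}e res_inf_rec res_zero_rec => e.
transitivity (gbinom K a m); first by rewrite -e; ring.
by rewrite gbinom_pascal; ring.
Qed.

(** The coefficient of [x0^m] in [(1 + x0)^a], for every integer [m]; it vanishes
    for [m < 0], and so does the right-hand side because [(x - 1)^(-m-1)] is then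
    a polynomial. *)
Lemma subst_coefE (a m : int) :
  binom_pow (1 : K) a (a - m) m = res_inf (- m - 1) a - res_zero (- m - 1) a.
Proof.
rewrite /binom_pow subrK eqxx andbT; case: m => m /=.
  by rewrite expr1n mul1r res_inf_sub_zero.
have -> : - Negz m - 1 = m by lia.
by rewrite res_inf_zeroE subrr.
Qed.

Lemma res_inf_small n a : a < - n - 1 -> res_inf n a = 0.
Proof. by move=> h; apply: sbinom_lt0; lia. Qed.

Lemma res_zero_large n a : -1 < a -> res_zero n a = 0.
Proof. by move=> h; rewrite /res_zero sbinom_lt0 ?mulr0//; lia. Qed.

End Residues.

(** * Moving powers of x - 1 across a residue pairing *)

Section SummationByParts.
Variables (K : numFieldType) (W : lmodType K).

(** With [c n] the residues of [x^a (x - 1)^n] in some expansion and [F k] the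
    coefficients of [(x - 1)^k F_0(x)], both sides are the residue of
    [(x - 1)^(n+k) F_0(x)] in that expansion. *)
Lemma summation_by_parts (c : int -> int -> K) (F : nat -> int -> W) :
  (forall n a, c (n + 1) a = c n (a + 1) - c n a) ->
  (forall k a, F k.+1 a = F k (a - 1) - F k a) ->
  (forall n k d, finsupp (fun a => c n a *: F k (a + d))) ->
  forall k n, \sum_(a \in setT) c n a *: F k a
              = \sum_(a \in setT) c (n + k%:Z) a *: F 0%N a.
Proof.
move=> cS FS fin; elim=> [|k IH] n; first by rewrite addr0.
have -> : n + k.+1%:Z = (n + 1) + k by lia.
rewrite -IH.
under eq_fsbigr => a _ do rewrite FS scalerBr.
under [in RHS]eq_fsbigr => a _ do rewrite cS scalerBl.
have fin0 n' k' : finsupp (fun a => c n' a *: F k' a).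
  by have := fin n' k' 0; under eq_fun do rewrite addr0.
have fin1 : finsupp (fun a => c n (a + 1) *: F k a).
  rewrite /finsupp; apply: (@sub_finite_set _ _
     ((fun a => a - 1) @` [set a | c n a *: F k (a - 1) != 0])).
    by move=> a /= ha; exists (a + 1); rewrite addrK.
  exact: (finite_image _ (fin n k (-1))).
rewrite !fsum_subr//; congr (_ - _).
rewrite -(fsum_shift _ 1); apply: eq_fsbigr => a _; by rewrite addrK.
Qed.

End SummationByParts.

(** * Multiplication by (x - 1)^k *)

Section Expansions.
Variables (K : numFieldType) (W : lmodType K).
Implicit Types (g h : int -> W).

(** Coefficients of [(x - 1)^k g(x)], for an arbitrary series [g].  The
    coefficient of [x^(-b-1)] in the polynomial [(x - 1)^k] is written as
    [res_inf K k b], so that it is nonzero only for [- k - 1 <= b <= -1]. *)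
Definition mul_xB1 (k : nat) g : int -> W := fun a =>
  \sum_(b \in setT) res_inf K k b *: g (a + b + 1).

Lemma finsupp_mul_xB1 (k : nat) g (a d : int) :
  finsupp (fun b => res_inf K k (b + d) *: g (a + b)).
Proof.
apply: (@finsupp_bounded _ _ (- k%:Z - 1 - d) (- 1 - d)) => b hb.
  by rewrite res_inf_small ?scale0r//; lia.
by rewrite res_inf_zeroE res_zero_large ?scale0r//; lia.
Qed.

Lemma mul_xB1_0 g : mul_xB1 0 g =1 g.
Proof.
move=> a; rewrite /mul_xB1 (@fsum_single _ _ _ (-1)).
  by rewrite addrNK /res_inf sbinom0 add0r addNr eqxx scale1r.
move=> b hb; rewrite /res_inf sbinom0 add0r addr_eq0 (negbTE hb).
by rewrite scale0r.
Qed.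

Lemma mul_xB1_S (k : nat) g (a : int) :
  mul_xB1 k.+1 g a = mul_xB1 k g (a - 1) - mul_xB1 k g a.
Proof.
have fin d d' : finsupp (fun b => res_inf K k (b + d) *: g (a + b + d')).
  have := finsupp_mul_xB1 k g (a + d') d.
  by under eq_fun do rewrite addrAC.
rewrite /mul_xB1.
under eq_fsbigr => b _ do
  rewrite -addn1 PoszD res_inf_rec scalerBl.
rewrite fsum_subr; last 2 first.
- exact: fin.
- by have := fin 0 1; under eq_fun do rewrite addr0.
congr (_ - _); rewrite -(fsum_shift (fun b => _ *: g (a - 1 + b + 1)) 1).
by apply: eq_fsbigr => b _; congr (_ *: g _); lia.
Qed.

Lemma mul_xB1_below (k : nat) g (L a : int) :
  (forall b, b < L -> g b = 0) -> a < L -> mul_xB1 k g a = 0.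
Proof.
move=> gL aL; apply: fsbig1 => b _; have [b0|b0] := ltP (-1) b.
  by rewrite res_inf_zeroE res_zero_large ?scale0r.
by rewrite gL ?scaler0//; lia.
Qed.

Lemma mul_xB1_above (k : nat) g (U a : int) :
  (forall b, U < b -> g b = 0) -> U + k%:Z < a -> mul_xB1 k g a = 0.
Proof.
move=> gU aU; apply: fsbig1 => b _; have [b0|b0] := ltP b (- k%:Z - 1).
  by rewrite res_inf_small ?scale0r.
by rewrite gU ?scaler0//; lia.
Qed.

(** Let [P = (x - 1)^k g = (x - 1)^k h] with [g] bounded above and [h] bounded
    below, so that [P] is a Laurent polynomial.  The left-hand side is the
    coefficient of [x0^m] in [P(1 + x0)]; the right-hand side is the difference of
    the residues of [(x - 1)^(k-m-1) g] and [(x - 1)^(k-m-1) h], with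
    the powers expanded at infinity and at zero respectively. *)
Lemma residue_sum (k : nat) g h (m L U : int) :
  (forall a, U < a -> g a = 0) -> (forall a, a < L -> h a = 0) ->
  mul_xB1 k g =1 mul_xB1 k h ->
  \sum_(a \in setT) binom_pow (1 : K) a (a - m) m *: mul_xB1 k g a
  = \sum_(a \in setT) res_inf K (k%:Z - m - 1) a *: g a
    - \sum_(a \in setT) res_zero K (k%:Z - m - 1) a *: h a.
Proof.
move=> gU hL gh.
have fing n j d : finsupp (fun a => res_inf K n a *: mul_xB1 j g (a + d)).
  apply: (@finsupp_bounded _ _ (- n - 1) (U + j - d)) => a ha.
    by rewrite res_inf_small ?scale0r.
  by rewrite (mul_xB1_above gU) ?scaler0//; lia.
have finh n j d : finsupp (fun a => res_zero K n a *: mul_xB1 j h (a + d)).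
  apply: (@finsupp_bounded _ _ (L - d) (-1)) => a ha.
    by rewrite (mul_xB1_below _ hL) ?scaler0//; lia.
  by rewrite res_zero_large ?scale0r.
have -> : k%:Z - m - 1 = - m - 1 + k%:Z by lia.
under [X in _ = X - _]eq_fsbigr => a _ do rewrite -(mul_xB1_0 g).
under [X in _ = _ - X]eq_fsbigr => a _ do rewrite -(mul_xB1_0 h).
rewrite -(summation_by_parts (F := fun j => mul_xB1 j g)); last 3 first.
- exact: res_inf_rec.
- by move=> j a; exact: mul_xB1_S.
- exact: fing.
rewrite -(summation_by_parts (F := fun j => mul_xB1 j h)); last 3 first.
- exact: res_zero_rec.
- by move=> j a; exact: mul_xB1_S.
- exact: finh.
rewrite -fsum_subr; last 2 first.
- by have := fing (- m - 1) k 0; under eq_fun do rewrite addr0.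
- by have := finh (- m - 1) k 0; under eq_fun do rewrite addr0.
by apply: eq_fsbigr => a _; rewrite subst_coefE scalerBl gh.
Qed.

(** * Products with homogeneous series in three variables *)

(** A product whose second factor is free of [x0], and whose first one is
    homogeneous of degree [n] in [x1, x2] at the power [x0^p0], is a sum along a
    line.  The parameter [a] makes [x1^(-a-1)] the power taken from the first
    factor. *)
Lemma fmul_line (f : fseries3 K) (g : fseries3 W) (n p0 p1 p2 : int) :
  (forall q0 q1 q2, q0 != 0 -> g (q0, q1, q2) = 0) ->
  (forall q1 q2, q1 + q2 != n -> f (p0, q1, q2) = 0) ->
  fmul f g (p0, p1, p2) =
  \sum_(a \in setT)
     f (p0, - a - 1, n + a + 1) *: g (0, p1 + a + 1, p2 - n - a - 1).
Proof.
move=> g0 fn; rewrite /fmul.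
rewrite (@fsum_injective _ _ _ (fun a : int => (p0, - a - 1, n + a + 1))).
- apply: eq_fsbigr => a _; congr (_ *: g _).
  by congr (_, _, _); rewrite /=; lia.
- by move=> a b [/addIr/oppr_inj].
move=> [[q0 q1] q2] /= hq; exists (- q1 - 1).
have q0E : q0 = p0.
  apply/eqP; apply: contraNT hq => hq.
  by rewrite g0 ?scaler0//; rewrite subr_eq0 eq_sym.
have q12 : q1 + q2 = n.
  by apply/eqP; apply: contraNT hq => hq; rewrite q0E fn ?scale0r.
by congr (_, _, _); lia.
Qed.

Lemma pow_x1Bx2_lineE (k : nat) (g : fseries3 W) (p1 p2 : int) :
  (forall q0 q1 q2, q0 != 0 -> g (q0, q1, q2) = 0) ->
  fmul (pow_x1Bx2 K k) g (0, p1, p2) =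
  mul_xB1 k (fun a => g (0, a, p1 + p2 - k%:Z - a)) p1.
Proof.
move=> g0; rewrite (fmul_line _ _ (n := k)) //=; last first.
  by move=> q1 q2 hq; rewrite binom_pow_sbinom (negbTE hq).
apply: eq_fsbigr => a _; rewrite binom_pow_sbinom.
have -> : - a - 1 + (k%:Z + a + 1) == k by lia.
by congr (_ *: g (_, _, _)); lia.
Qed.

Lemma delta_12_0_lineE (g : fseries3 W) (p0 p1 p2 : int) :
  (forall q0 q1 q2, q0 != 0 -> g (q0, q1, q2) = 0) ->
  fmul (delta_12_0 K) g (p0, p1, p2) =
  \sum_(a \in setT)
    res_inf K (- p0 - 1) a *: g (0, p1 + a + 1, p2 + p0 - a).
Proof.
move=> g0; rewrite (fmul_line _ _ (n := - p0 - 1)) //=; last first.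
  by move=> q1 q2 hq; rewrite binom_pow_sbinom (negbTE hq).
apply: eq_fsbigr => a _; rewrite binom_pow_sbinom.
have -> : - a - 1 + (- p0 - 1 + a + 1) == - p0 - 1 by lia.
by congr (_ *: g (_, _, _)); lia.
Qed.

Lemma delta_21_N0_lineE (g : fseries3 W) (p0 p1 p2 : int) :
  (forall q0 q1 q2, q0 != 0 -> g (q0, q1, q2) = 0) ->
  fmul (delta_21_N0 K) g (p0, p1, p2) =
  \sum_(a \in setT)
    res_zero K (- p0 - 1) a *: g (0, p1 + a + 1, p2 + p0 - a).
Proof.
move=> g0; rewrite (fmul_line _ _ (n := - p0 - 1)) //=; last first.
  by move=> q1 q2 hq; rewrite binom_pow_sbinom (addrC q2) (negbTE hq) mulr0.
apply: eq_fsbigr => a _; rewrite binom_pow_sbinom.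
have -> : - p0 - 1 + a + 1 + (- a - 1) == - p0 - 1 by lia.
by congr (_ *: g (_, _, _)); lia.
Qed.

(** [Res_{x1}] of the third delta series is [1]. *)
Lemma delta_10_2_residue (g : fseries3 W) (p0 p2 : int) :
  (forall q0 q1 q2, q1 != 0 -> g (q0, q1, q2) = 0) ->
  fmul (delta_10_2 K) g (p0, -1, p2) = g (p0, 0, p2).
Proof.
move=> g1; rewrite /fmul (@fsum_single _ _ _ (0, -1, 0)).
  rewrite /= binom_pow_sbinom /= /sbinom /= gbinom0 mulr1 scale1r.
  by congr (g (_, _, _)); rewrite /= ?subr0 ?subrr.
move=> [[q0 q1] q2] /= hq; rewrite binom_pow_sbinom.
have [q1E|q1N] := eqVneq q1 (-1); last first.
  by rewrite g1 ?scaler0//=; lia.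
case: ifP => [/eqP q2E|_]; last by rewrite scale0r.
case: q0 hq q2E => [[|j]|j] hq q2E.
- by case/negP: hq; apply/eqP; congr (_, _, _) => //; lia.
- have -> : - q2 - 1 = j by lia.
  have -> : j.+1%:Z = j%:Z + 0 + 1 by lia.
  (* The polynomial (1 - z)^j has no term in z^(j+1). *)
  by rewrite -/(res_inf K j 0) res_inf_zeroE res_zero_large// scale0r.
- by rewrite sbinom_lt0// scale0r.
Qed.

Lemma fmul_pow_x0 (k : nat) (g : fseries3 W) (p0 p1 p2 : int) :
  fmul (pow_x0 K k) g (p0, p1, p2) = g (p0 - k%:Z, p1, p2).
Proof.
rewrite /fmul (@fsum_single _ _ _ (k%:Z, 0, 0)).
  by rewrite /pow_x0 eqxx scale1r; congr (g (_, _, _)); rewrite /= ?subr0.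
by move=> q hq; rewrite /pow_x0 (negbTE hq) scale0r.
Qed.

End Expansions.

(** * Modules *)

Section Modules.
Variables (K : numFieldType) (V W : lmodType K).
Variables (Y : modes V V) (YW : modes V W).

Lemma prod_12_x0 (u v : V) (w : W) (q0 q1 q2 : int) :
  q0 != 0 -> prod_12 YW u v w (q0, q1, q2) = 0.
Proof. by move=> /= /negbTE ->. Qed.

Lemma prod_21_x0 (u v : V) (w : W) (q0 q1 q2 : int) :
  q0 != 0 -> prod_21 YW u v w (q0, q1, q2) = 0.
Proof. by move=> /= /negbTE ->. Qed.

Lemma iterate_02_x1 (u v : V) (w : W) (q0 q1 q2 : int) :
  q1 != 0 -> iterate_02 Y YW u v w (q0, q1, q2) = 0.
Proof. by move=> /= /negbTE ->. Qed.

Hypotheses (YW_linear : linear_modes YW) (Y_truncation : truncation Y).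
Hypotheses (YW_truncation : truncation YW) (YW_jacobi : jacobi Y YW).

Lemma modes0 (n : int) (w : W) : YW 0 n w = 0.
Proof.
have := YW_linear n w 1 0 0; rewrite !scale1r addr0 => h.
by apply: (addrI (YW 0 n w)); rewrite addr0.
Qed.

Lemma fmul_pow_x1Bx2_x0 (k : nat) (g : fseries3 W) (p0 p1 p2 : int) :
  (forall q0 q1 q2, q0 != 0 -> g (q0, q1, q2) = 0) ->
  p0 != 0 -> fmul (pow_x1Bx2 K k) g (p0, p1, p2) = 0.
Proof.
move=> g0 hp; apply: fsbig1 => -[[q0 q1] q2] _ /=.
case: eqVneq => [->|_]; last by rewrite scale0r.
by rewrite g0 ?scaler0//= subr0.
Qed.

Lemma weak_commutativity_exists (u v : V) :
  exists k, weak_commutativity YW u v k.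
Proof.
have [N uvN] := Y_truncation u v.
(* The coefficients u_n v with n >= k vanish for this k, which is at least N. *)
exists `|N|%N => w [[p0 p1] p2].
have [->|p0N] := eqVneq p0 0; last first.
  rewrite !fmul_pow_x1Bx2_x0//; [exact: prod_21_x0|exact: prod_12_x0].
rewrite !pow_x1Bx2_lineE; [|exact: prod_21_x0|exact: prod_12_x0].
set k := `|N|%N.
have := YW_jacobi u v w (- k%:Z - 1, p1, p2).
rewrite delta_12_0_lineE ?delta_21_N0_lineE;
  [|exact: prod_21_x0|exact: prod_12_x0].
rewrite [RHS]fsbig1; last first.
  move=> [[q0 q1] q2] _ /=; rewrite binom_pow_sbinom.
  have [q0N|q0P] := ltP q0 0; first by rewrite sbinom_lt0// if_same scale0r.
  by rewrite uvN ?modes0 ?if_same ?scaler0//; lia.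
move/eqP; rewrite subr_eq0 => /eqP e.
have kE : - (- k%:Z - 1) - 1 = k%:Z by lia.
rewrite kE in e; rewrite /mul_xB1.
have idx a : p1 + p2 - k%:Z - (p1 + a + 1) = p2 + (- k%:Z - 1) - a by lia.
under eq_fsbigr => a _ do rewrite idx.
under [RHS]eq_fsbigr => a _ do rewrite idx res_inf_zeroE.
exact: e.
Qed.

Lemma minimal_comm_order_exists (u v : V) : exists k, is_comm_order YW u v k.
Proof.
have ex : exists k, `[< weak_commutativity YW u v k >].
  by have [k kP] := weak_commutativity_exists u v; exists k; apply/asboolP.
exists (ex_minn ex); case: ex_minnP => k /asboolP kP kmin; split=> // j jP.
by apply: kmin; apply/asboolP.
Qed.

(** The coefficients of [x1^(-1)] in the Jacobi identity: each mode of
    [Y(u,x0)v] is a combination of products of modes of [u] and [v]. *)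
Lemma iterate_residue (u v : V) (w : W) (p0 p2 : int) :
  iterate_02 Y YW u v w (p0, 0, p2) =
  \sum_(a \in setT)
    res_inf K (- p0 - 1) a *: prod_12 YW u v w (0, a, p2 + p0 - a)
  - \sum_(a \in setT)
    res_zero K (- p0 - 1) a *: prod_21 YW u v w (0, a, p2 + p0 - a).
Proof.
have := YW_jacobi u v w (p0, -1, p2).
rewrite delta_12_0_lineE ?delta_21_N0_lineE;
  [|exact: prod_21_x0|exact: prod_12_x0].
rewrite delta_10_2_residue; last exact: iterate_02_x1.
move=> <-; congr (_ - _); apply: eq_fsbigr => a _;
  by have -> : -1 + a + 1 = a by lia.
Qed.

Lemma prod_12_above (u v : V) (w : W) (s : int) :
  exists U : int, forall a, U < a -> prod_12 YW u v w (0, a, s - a) = 0.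
Proof.
have [N vN] := YW_truncation v w.
by exists (s + N + 1) => a ha; rewrite /= vN ?linear0//; lia.
Qed.

Lemma prod_21_below (u v : V) (w : W) (s : int) :
  exists L : int, forall a, a < L -> prod_21 YW u v w (0, a, s - a) = 0.
Proof.
have [N uN] := YW_truncation u w.
by exists (- N - 1) => a ha; rewrite /= uN ?linear0//; lia.
Qed.

Section WeaklyCommuting.
Variables (u v : V) (k : nat) (wc : weak_commutativity YW u v k) (w : W).

(* [g s] and [h s] are the coefficients of Y_W(u,x1)Y_W(v,x2)w and
   Y_W(v,x2)Y_W(u,x1)w in total degree s - k, indexed by the power of x1; in
   total degree s, F is (x - 1)^k times either of them. *)
Let F : fseries3 W := fmul (pow_x1Bx2 K k) (prod_12 YW u v w).
Let g (s : int) : int -> W := fun a => prod_12 YW u v w (0, a, s - k%:Z - a).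
Let h (s : int) : int -> W := fun a => prod_21 YW u v w (0, a, s - k%:Z - a).

Lemma slice_12 (s a : int) : F (0, a, s - a) = mul_xB1 k (g s) a.
Proof.
rewrite /F pow_x1Bx2_lineE; last exact: prod_12_x0.
by rewrite [a + _]addrC subrK.
Qed.

Lemma slice_21 (s a : int) : F (0, a, s - a) = mul_xB1 k (h s) a.
Proof.
rewrite /F wc pow_x1Bx2_lineE; last exact: prod_21_x0.
by rewrite [a + _]addrC subrK.
Qed.

Lemma finite_slice (s : int) : finite_set [set a : int | F (0, a, s - a) != 0].
Proof.
have [U gU] := prod_12_above u v w (s - k%:Z).
have [L hL] := prod_21_below u v w (s - k%:Z).
apply: (@finsupp_bounded _ _ L (U + k%:Z)) => a ha.
- by rewrite slice_21 (mul_xB1_below _ hL).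
- by rewrite slice_12 (mul_xB1_above gU).
Qed.

Lemma subst_term_support (p0 p1 p2 : int) (q : expo) :
  subst_term F (p0, p1, p2) q != 0 ->
  [/\ p1 = 0, q = (0, q.1.2, p0 + p2 - q.1.2) & F q != 0].
Proof.
case: q => [[q0 q1] q2] /= nz.
have q0E : q0 = 0.
  apply/eqP; apply: contraNT nz => hq.
  by rewrite /F fmul_pow_x1Bx2_x0 ?scaler0//; exact: prod_12_x0.
have nzF : F (q0, q1, q2) != 0.
  by apply: contraNneq nz => ->; rewrite scaler0.
move: nz; have [->|p1N] := eqVneq p1 0; last by rewrite scale0r eqxx.
rewrite /binom_pow; case: ifP => [/andP[_ /eqP e] _|_]; last first.
  by rewrite scale0r eqxx.
by split=> //; congr (_, _, _) => //; lia.
Qed.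

Lemma formal_lim_exists_of_weak_commutativity : formal_lim_exists F.
Proof.
move=> [[p0 p1] p2].
apply: (@sub_finite_set _ _ ((fun a : int => (0, a, p0 + p2 - a) : expo) @`
   [set a | F (0, a, p0 + p2 - a) != 0])); last first.
  exact/finite_image/finite_slice.
move=> q /= /subst_term_support[_ qE Fq].
by exists q.1.2; rewrite -?qE.
Qed.

Lemma formal_lim_of_weak_commutativity :
  formal_lim F =1 fmul (pow_x0 K k) (iterate_02 Y YW u v w).
Proof.
move=> [[p0 p1] p2]; rewrite fmul_pow_x0.
have [->|p1N] := eqVneq p1 0; last first.
  rewrite iterate_02_x1// /formal_lim fsbig1// => q _.
  apply/eqP/negPn/negP => /subst_term_support[p10 _ _].
  by rewrite p10 eqxx in p1N.
rewrite iterate_residue /formal_lim.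
rewrite (@fsum_injective _ _ _ (fun a : int => (0, a, p0 + p2 - a))); first last.
- by move=> q /subst_term_support[_ qE _]; exists q.1.2; rewrite -qE.
- by move=> a b [].
have [U gU] := prod_12_above u v w (p0 + p2 - k%:Z).
have [L hL] := prod_21_below u v w (p0 + p2 - k%:Z).
have gh : mul_xB1 k (g (p0 + p2)) =1 mul_xB1 k (h (p0 + p2)).
  by move=> a; rewrite -slice_12 slice_21.
have nE : - (p0 - k%:Z) - 1 = k%:Z - p0 - 1 by lia.
have dE : p2 + (p0 - k%:Z) = p0 + p2 - k%:Z by lia.
rewrite nE dE -(residue_sum p0 gU hL gh).
apply: eq_fsbigr => a _; rewrite /= slice_12 subr0.
by have -> : p2 - (p0 + p2 - a) = a - p0 by lia.
Qed.

End WeaklyCommuting.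

End Modules.

Theorem theorem3p5 (R : realType) (V : lmodType R[i]) (A : voa V)
    (W : lmodType R[i]) (YW : modes V W)
    (YW_linear : linear_modes YW)
    (YW_truncation : truncation YW)
    (YW_jacobi : jacobi (voa_Y A) YW)
    (u v : V) :
  exists k : nat, is_comm_order YW u v k /\
    forall w : W,
      formal_lim_exists (fmul (pow_x1Bx2 _ k) (prod_12 YW u v w)) /\
      formal_lim (fmul (pow_x1Bx2 _ k) (prod_12 YW u v w))
        =1 fmul (pow_x0 _ k) (iterate_02 (voa_Y A) YW u v w).
Proof.
have [k kP] :=
  minimal_comm_order_exists YW_linear (voa_truncation A) YW_jacobi u v.
have [wc _] := kP; exists k; split=> // w; split.
- exact: formal_lim_exists_of_weak_commutativity.
- exact: formal_lim_of_weak_commutativity.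
Qed.
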